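(* Let $A$ and $B$ be $n\times n$ sign patterns with $A\trianglelefteq B$, i.e. for every $X\in Q(A)$ there exists $\alpha\in\mathbb{R}$ such that the sign pattern of $X+\alpha I_n$ is equivalent to $B$. Then: (1) if $B$ requires algebraic positivity, then so does $A$; (2) if $A$ allows algebraic positivity, then so does $B$.
   Context: A sign pattern is a matrix with entries in $\{+,-,0\}$; for a sign pattern $S$, $Q(S)$ is the set of real matrices $X$ of the same size with $\mathrm{sgn}(X_{ij})=S_{ij}$ for all $i,j$. Two square sign patterns are equivalent if one can be obtained from the other by any combination of transposition, permutation similarity ($S\mapsto PSP^T$ with $P$ a permutation matrix), and negation. A real square matrix $M$ is algebraically positive if there is a real polynomial $p$ with all entries of $p(M)$ positive. A sign pattern $S$ allows algebraic positivity if some $X\in Q(S)$ is algebraically positive, and requires algebraic positivity if every $X\in Q(S)$ is algebraically positive. *)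

(* Defs.v *)
From mathcomp Require Import all_boot all_order all_fingroup all_algebra.
From mathcomp Require Import reals.
Set Implicit Arguments.
Unset Strict Implicit.
Unset Printing Implicit Defensive.
Import Order.TTheory GRing.Theory Num.Theory.
Local Open Scope ring_scope.

Variant sign := Plus | Minus | Zero.

Definition opps (s : sign) : sign :=
  match s with Plus => Minus | Minus => Plus | Zero => Zero end.

Definition sgn (R : realType) (x : R) : sign :=
  if 0 < x then Plus else if x < 0 then Minus else Zero.

Definition sign_pattern_of (R : realType) (n : nat) (X : 'M[R]_n) : 'M[sign]_n :=
  map_mx (@sgn R) X.

Definition qual_class (R : realType) (n : nat) (S : 'M[sign]_n) (X : 'M[R]_n)
    : Prop :=
  forall i j, sgn (X i j) = S i j.

(* Entry (i, j) of [row_perm s (col_perm s S)] is [S (s i) (s j)], which is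
   P S P^T for P = [perm_mx s]; [sign] carries no ring structure, so the
   product itself cannot be written. *)
Inductive sp_equiv (n : nat) (S : 'M[sign]_n) : 'M[sign]_n -> Prop :=
| sp_equiv_refl : sp_equiv S S
| sp_equiv_tr T : sp_equiv S T -> sp_equiv S T^T
| sp_equiv_perm T (s : 'S_n) :
    sp_equiv S T -> sp_equiv S (row_perm s (col_perm s T))
| sp_equiv_opp T : sp_equiv S T -> sp_equiv S (map_mx opps T).

(* Sizes are successors because [horner_mx] needs the matrix ring to be
   nontrivial. *)
Definition algebraically_positive (R : realType) (n : nat) (M : 'M[R]_n.+1)
    : Prop :=
  exists p : {poly R}, forall i j, 0 < horner_mx M p i j.

Definition allows_alg_pos (R : realType) (n : nat) (S : 'M[sign]_n.+1) : Prop :=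
  exists X : 'M[R]_n.+1, qual_class S X /\ algebraically_positive X.

Definition requires_alg_pos (R : realType) (n : nat) (S : 'M[sign]_n.+1) : Prop :=
  forall X : 'M[R]_n.+1, qual_class S X -> algebraically_positive X.

(* The relation A ⊴ B. *)
Definition sp_le (R : realType) (n : nat) (A B : 'M[sign]_n) : Prop :=
  forall X : 'M[R]_n, qual_class A X ->
    exists alpha : R, sp_equiv (sign_pattern_of (X + alpha%:M)) B.

(* Main.v *)
Require Import Defs.
From mathcomp Require Import all_boot all_order all_algebra.
From mathcomp Require Import reals.
From mathcomp Require Import perm.
Import Order.TTheory GRing.Theory Num.Theory.
Local Open Scope ring_scope.

Set Implicit Arguments.
Unset Strict Implicit.
Unset Printing Implicit Defensive.

(** Algebraic positivity depends only on the set of polynomials in [M]: it is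
    therefore unchanged by [M |-> M + a I] and [M |-> - M], and also by
    transposition and simultaneous permutation of rows and columns, which
    commute with polynomials and merely move entries. Every operation in an
    equivalence of sign patterns thus lifts from the pattern to any of its
    realizations without affecting algebraic positivity. *)

Lemma horner_mx_comp_poly (R : comNzRingType) (n : nat) (M : 'M[R]_n.+1)
    (p q : {poly R}) :
  horner_mx M (p \Po q) = horner_mx (horner_mx M q) p.
Proof.
elim/poly_ind: p => [|p c IHp]; first by rewrite comp_poly0 !rmorph0.
by rewrite comp_poly_MXaddC !rmorphD !rmorphM /= IHp horner_mx_X !horner_mx_C.
Qed.

Lemma horner_mx_tr (R : comNzRingType) (n : nat) (M : 'M[R]_n.+1)
    (p : {poly R}) :
  horner_mx M^T p = (horner_mx M p)^T.
Proof.
elim/poly_ind: p => [|p c IHp]; first by rewrite !rmorph0 trmx0.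
rewrite !rmorphD !rmorphM /= IHp !horner_mx_X !horner_mx_C linearD /=.
(* Transposition reverses the product; the order is restored because [M] commutes with every
   polynomial in [M]. *)
by rewrite -!mulmxE -trmx_mul tr_scalar_mx [in LHS]comm_mx_horner.
Qed.

Lemma horner_mx_perm (R : comNzRingType) (n : nat) (M : 'M[R]_n.+1)
    (s : 'S_n.+1) (p : {poly R}) :
  horner_mx (row_perm s (col_perm s M)) p
    = row_perm s (col_perm s (horner_mx M p)).
Proof.
elim/poly_ind: p => [|p c IHp].
  by rewrite !rmorph0; apply/matrixP => i j; rewrite !mxE.
rewrite !rmorphD !rmorphM /= IHp !horner_mx_X !horner_mx_C -!mulmxE.
(* Injectivity of [s] keeps the scalar term on the diagonal; the products agree after the summation
   index is relabelled by [s]. *)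
apply/matrixP => i j; rewrite !mxE (inj_eq perm_inj); congr (_ + _).
by rewrite [RHS](reindex_perm s); apply: eq_bigr => k _; rewrite !mxE.
Qed.

Section AlgebraicPositivity.
Variables (R : realType) (n : nat).
Implicit Types (M : 'M[R]_n.+1) (s : 'S_n.+1).

(** A polynomial in a polynomial in [M] is again a polynomial in [M]. The converse fails for
    constant [q], so the equivalences below apply this once for each direction. *)
Lemma alg_pos_horner M (q : {poly R}) :
  algebraically_positive (horner_mx M q) -> algebraically_positive M.
Proof.
by case=> p p_gt0; exists (p \Po q) => i j; rewrite horner_mx_comp_poly.
Qed.

Lemma alg_pos_shift M (a : R) :
  algebraically_positive (M + a%:M) <-> algebraically_positive M.
Proof.
have shiftW (N : 'M[R]_n.+1) b :
    algebraically_positive (N + b%:M) -> algebraically_positive N.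
  by move=> posN; apply: (@alg_pos_horner _ ('X + b%:P));
     rewrite rmorphD /= horner_mx_X horner_mx_C.
split; first exact: shiftW.
by move=> posM; apply: (shiftW _ (- a)); rewrite raddfN /= addrK.
Qed.

Lemma alg_pos_opp M : algebraically_positive (- M) <-> algebraically_positive M.
Proof.
have oppW (N : 'M[R]_n.+1) : algebraically_positive (- N) -> algebraically_positive N.
  by move=> posN; apply: (@alg_pos_horner _ (- 'X));
     rewrite rmorphN /= horner_mx_X.
by split; [exact: oppW | move=> posM; apply: oppW; rewrite opprK].
Qed.

Lemma alg_pos_tr M : algebraically_positive M^T <-> algebraically_positive M.
Proof.
have trW (N : 'M[R]_n.+1) : algebraically_positive N -> algebraically_positive N^T.
  by case=> p p_gt0; exists p => i j; rewrite horner_mx_tr mxE.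
by split; [move/trW; rewrite trmxK | exact: trW].
Qed.

Lemma alg_pos_perm M s :
  algebraically_positive (row_perm s (col_perm s M))
    <-> algebraically_positive M.
Proof.
split=> -[p p_gt0]; exists p => i j.
  (* The permuted matrix carries entry [(i, j)] of [p(M)] at the preimages of [i] and [j] under
     [s]. *)
  have := p_gt0 ((s^-1)%g i) ((s^-1)%g j).
  by rewrite horner_mx_perm !mxE !permKV.
by rewrite horner_mx_perm !mxE.
Qed.

Lemma sgnN (x : R) : sgn (- x) = opps (sgn x).
Proof. by rewrite /sgn oppr_gt0 oppr_lt0; case: ltgtP. Qed.

(** Induction on the equivalence, starting from [M] and applying to the current realization the
    operation just applied to its pattern. *)
Lemma sp_equiv_realization M (T : 'M[sign]_n.+1) :
  sp_equiv (sign_pattern_of M) T ->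
  exists2 Y : 'M[R]_n.+1, qual_class T Y &
    algebraically_positive Y <-> algebraically_positive M.
Proof.
elim=> [|U _ [Y UY posY]|U s _ [Y UY posY]|U _ [Y UY posY]].
- by exists M => // i j; rewrite mxE.
- exists Y^T; first by move=> i j; rewrite !mxE UY.
  exact: iff_trans (alg_pos_tr Y) posY.
- exists (row_perm s (col_perm s Y)); first by move=> i j; rewrite !mxE UY.
  exact: iff_trans (alg_pos_perm Y s) posY.
- exists (- Y); first by move=> i j; rewrite !mxE sgnN UY.
  exact: iff_trans (alg_pos_opp Y) posY.
Qed.

(** An equivalence is kept because part (1) of the theorem carries positivity from [Y] back to [M],
    and part (2) from [M] to [Y]. *)
Lemma sp_le_realization (A B : 'M[sign]_n.+1) M :
  sp_le R A B -> qual_class A M ->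
  exists2 Y : 'M[R]_n.+1, qual_class B Y &
    algebraically_positive Y <-> algebraically_positive M.
Proof.
move=> leAB /leAB[a /sp_equiv_realization[Y BY posY]]; exists Y => //.
exact: iff_trans posY (alg_pos_shift M a).
Qed.

End AlgebraicPositivity.

Theorem theorem5 (R : realType) (n : nat) (A B : 'M[sign]_n.+1)
    (hAB : sp_le R A B) :
  (requires_alg_pos R B -> requires_alg_pos R A) /\
  (allows_alg_pos R A -> allows_alg_pos R B).
Proof.
split=> [reqB X AX | [X [AX posX]]];
  have [Y BY posYX] := sp_le_realization hAB AX.
  exact/posYX/reqB.
by exists Y; split=> //; apply/posYX.
Qed.
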